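(* Let $T$ be an invertible measure preserving transformation on a probability space $(\Omega,\Sigma,\mu)$ with index $N_T\in[1,\infty]$, and let $C_T^\ast$ be the associated Tauberian constant function. Then $C_T^\ast\in C^\infty(0,1)$ if and only if $N_T=1$ or $N_T=\infty$.
   Context: Index: if for every positive integer $N$ there exists a measurable set $A\subset\Omega$ with $\mu(A)>0$ such that the sets $A,TA,\ldots,T^NA$ are pairwise disjoint, then $N_T=\infty$. Otherwise $N_T$ is the largest positive integer for which there exists a measurable set $A\subset\Omega$ with $\mu(A)>0$ such that the sets $A,TA,\ldots,T^{N_T-1}A$ are pairwise disjoint. Maximal operator and Tauberian constant: for $f$ on $\Omega$, $$T^\ast f(\omega)=\sup_{M\le 0\le N,\ M,N\in\mathbb{Z}}\frac{1}{N-M+1}\sum_{j=M}^N|f(T^j\omega)|,$$ and for $\alpha\in(0,1)$ $$C_T^\ast(\alpha)=\sup_{E\in\Sigma,\ \mu(E)>0}\frac{1}{\mu(E)}\mu(\{\omega\in\Omega: T^\ast\chi_E(\omega)>\alpha\}),$$ where $\chi_E$ is the indicator function of $E$. *)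

(* Defs.v *)
From HB Require Import structures.
From mathcomp Require Import all_boot all_order all_algebra.
From mathcomp Require Import all_classical all_reals all_analysis.

Set Implicit Arguments.
Unset Strict Implicit.
Unset Printing Implicit Defensive.

Import Order.TTheory GRing.Theory Num.Theory.
Import numFieldNormedType.Exports.

Local Open Scope classical_set_scope.
Local Open Scope ring_scope.

Record invertible_mpt (d : measure_display) (Omega : measurableType d)
    (R : realType) (mu : probability Omega R) := InvertibleMpt {
  mpt_fun :> Omega -> Omega ;
  mpt_inv : Omega -> Omega ;
  mpt_funK : cancel mpt_fun mpt_inv ;
  mpt_invK : cancel mpt_inv mpt_fun ;
  mpt_measurable_fun : measurable_fun [set: Omega] mpt_fun ;
  mpt_measurable_inv : measurable_fun [set: Omega] mpt_inv ;
  mpt_preserving : forall A : set Omega, measurable A ->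
    mu (mpt_fun @^-1` A) = mu A
}.

Section Transformation.
Context (d : measure_display) (Omega : measurableType d) (R : realType).
Context (mu : probability Omega R) (T : invertible_mpt mu).

Definition iterz (j : int) : Omega -> Omega :=
  match j with
  | Posz n => iter n T
  | Negz n => iter n.+1 (mpt_inv T)
  end.

Definition has_disjoint_iterates (K : nat) : Prop :=
  exists A : set Omega, [/\ measurable A, (0 < mu A)%E &
    trivIset `I_K (fun i : nat => iter i T @` A)].

Definition is_largest (P : set nat) (n : nat) : Prop :=
  P n /\ forall m, P m -> (m <= n)%N.

(* The default value 0 of xget is never taken, see mpt_index_finiteP below. *)
Definition mpt_index : \bar nat :=
  if `[< forall N : nat, (0 < N)%N -> has_disjoint_iterates N.+1 >]
  then +oo%E
  else (xget 0%N (is_largest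
         [set N | (0 < N)%N /\ has_disjoint_iterates N]))%:E.

(* The sum over the integers j in [M, N] is reindexed by j = M + i. *)
Definition maximal (f : Omega -> R) (omega : Omega) : \bar R :=
  ereal_sup [set y : \bar R | exists M N : int, [/\ M <= 0, 0 <= N &
    y = ((N - M + 1)%:~R^-1 *
         \sum_(0 <= i < (absz (N - M)%R).+1)
           `|f (iterz (M + i%:Z) omega)|)%:E]].

Definition tauberian (alpha : R) : \bar R :=
  ereal_sup [set y : \bar R | exists E : set Omega,
    [/\ measurable E, (0 < mu E)%E &
      y = ((mu E)^-1 *
           mu [set omega | (alpha%:E < maximal (\1_E) omega)%E])%E]].

Lemma has_disjoint_iterates_le (K L : nat) :
  (K <= L)%N -> has_disjoint_iterates L -> has_disjoint_iterates K.
Proof.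
move=> KL [A [mA A0 tA]]; exists A; split => //.
by apply: sub_trivIset tA => i /= iK; exact: leq_trans KL.
Qed.

Lemma has_disjoint_iterates1 : has_disjoint_iterates 1.
Proof.
exists setT; split; [exact: measurableT|by rewrite probability_setT lte01|].
by move=> [|i] [|j].
Qed.

Lemma mpt_index_pinftyP : mpt_index = +oo%E <->
  forall N : nat, (0 < N)%N -> has_disjoint_iterates N.+1.
Proof.
by rewrite /mpt_index; case: asboolP => // h; split.
Qed.

Lemma mpt_index_finiteP (n : nat) : mpt_index = n%:E <->
  is_largest [set N | (0 < N)%N /\ has_disjoint_iterates N] n.
Proof.
rewrite /mpt_index; case: asboolP => [h|h].
  split=> // -[[n0 _]] /(_ n.+1) /=; rewrite ltnn => absurd.
  by have := absurd (conj (ltn0Sn n) (h n n0)).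
have largest_uniq : is_subset1 (is_largest
    [set N | (0 < N)%N /\ has_disjoint_iterates N]).
  move=> a b [Pa la] [Pb lb].
  by apply/eqP; rewrite eqn_leq lb// la.
split=> [[<-]|hn]; last by rewrite (xget_subset1 _ hn).
have [N /not_implyP[N0 hN]] : exists N,
    ~ ((0 < N)%N -> has_disjoint_iterates N.+1) by exact/existsNP.
pose P m := (0 < m)%N && `[< has_disjoint_iterates m >].
have exP : exists m, P m.
  by exists 1%N; apply/andP; split=> //; apply/asboolP/has_disjoint_iterates1.
have bP m : P m -> (m <= N)%N.
  case/andP=> _ /asboolP hm; rewrite leqNgt; apply/negP => Nm.
  by apply: hN; exact: has_disjoint_iterates_le hm.
have [m /andP[m0 /asboolP hm] mmax] := ex_maxnP exP bP.
apply: (@xgetI _ _ _ m); split => // k [k0 hk].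
by apply: mmax; apply/andP; split=> //; exact/asboolP.
Qed.

End Transformation.

(* An extended-real-valued function is C^oo on D when it is finite on D and
   all its iterated derivatives exist there; each is then continuous on D,
   being differentiable. This is meant for open D: the iterated derivatives
   at a point only depend on f near that point. *)
Definition smooth_on (R : realType) (D : set R) (f : R -> \bar R) : Prop :=
  (forall x, D x -> f x \is a fin_num) /\
  (forall (n : nat) (x : R), D x -> derivable (derive1n n (fine \o f)) x 1).

(* Main.v *)
Require Import Defs.
From mathcomp Require Import all_boot all_order all_algebra.
From mathcomp Require Import all_classical all_reals all_analysis.
From mathcomp Require Import measurable_realfun.
From mathcomp Require Import zify ring lra.

(* Write E for a measurable set and G for the set where the maximal function of
   its indicator exceeds alpha.  A two-sided version of Garsia's argument gives
   alpha mu(G \ E) <= 2 (1 - alpha) mu(E), hence C(alpha) <= 2 / alpha - 1.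
   - If the index is infinite, unions of long blocks of disjoint iterates show
     that C(alpha) = 2 / alpha - 1.
   - If the index is 1, then G is contained in E up to a null set and C = 1.
   - If there are no N + 1 disjoint iterates, the orbit of B has measure at most
     N mu(B).  Restricting E to the orbits that meet G \ E then shows that C
     takes no value strictly between 1 and 1 + 1 / N.  The first bound makes C
     close to 1 near alpha = 1, and a set disjoint from its image makes C at
     least 1 + 1 / N for alpha < 1 / 2, so C is not continuous. *)

Set Implicit Arguments.
Unset Strict Implicit.
Unset Printing Implicit Defensive.

Import Order.TTheory GRing.Theory Num.Theory.
Import numFieldNormedType.Exports.

Local Open Scope classical_set_scope.
Local Open Scope ring_scope.

Section Transformation.
Context (d : measure_display) (Omega : measurableType d) (R : realType).
Context (mu : probability Omega R) (T : invertible_mpt mu).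

Local Notation Ti := (mpt_inv T).
Implicit Types (A B E : set Omega) (alpha : R) (N m n : nat) (w : Omega).

(** * Iterates, averages over windows, superlevel sets of the maximal function *)

Definition maximal_gt alpha E : set Omega :=
  [set w | (alpha%:E < maximal T (\1_E) w)%E].

Lemma measurable_iter n : measurable_fun [set: Omega] (iter n T).
Proof.
elim: n => [|n ih]; first exact: measurable_id.
by apply: measurableT_comp ih; exact: mpt_measurable_fun.
Qed.

Lemma measurable_iter_inv n : measurable_fun [set: Omega] (iter n Ti).
Proof.
elim: n => [|n ih]; first exact: measurable_id.
by apply: measurableT_comp ih; exact: mpt_measurable_inv.
Qed.

Lemma iterK n : cancel (iter n T) (iter n Ti).
Proof. by elim: n => // n ih w; rewrite [iter n.+1 T _]iterS iterSr mpt_funK. Qed.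

Lemma iter_invK n : cancel (iter n Ti) (iter n T).
Proof. by elim: n => // n ih w; rewrite [iter n.+1 Ti _]iterS iterSr mpt_invK. Qed.

Lemma measurable_preimage (f : Omega -> Omega) A :
  measurable_fun setT f -> measurable A -> measurable (f @^-1` A).
Proof. by move=> mf mA; rewrite -[X in measurable X]setTI; exact: mf. Qed.

Lemma mpt_preserving_iter n A : measurable A -> mu (iter n T @^-1` A) = mu A.
Proof.
elim: n A => // n ih A mA.
have -> : iter n.+1 T @^-1` A = iter n T @^-1` (T @^-1` A) by [].
rewrite ih ?mpt_preserving//.
by apply: measurable_preimage mA; exact: mpt_measurable_fun.
Qed.

Lemma mpt_preserving_iter_inv n A : measurable A ->
  mu (iter n Ti @^-1` A) = mu A.
Proof.
move=> mA.
rewrite -(mpt_preserving_iter n); last first.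
  by apply: measurable_preimage mA; exact: measurable_iter_inv.
by congr (mu _); apply/seteqP; split=> w /=; rewrite iterK.
Qed.

Lemma image_iterE n A : iter n T @` A = iter n Ti @^-1` A.
Proof.
apply/seteqP; split=> [_ [w Aw <-]|w Aw] /=; first by rewrite iterK.
by exists (iter n Ti w); rewrite // iter_invK.
Qed.

Lemma image_iter_measurable n A : measurable A -> measurable (iter n T @` A).
Proof.
rewrite image_iterE => mA.
by apply: measurable_preimage mA; exact: measurable_iter_inv.
Qed.

Lemma measure_image_iter n A : measurable A -> mu (iter n T @` A) = mu A.
Proof. by move=> mA; rewrite image_iterE mpt_preserving_iter_inv. Qed.

Lemma iterz_shift m i w : iterz T (- m%:Z + i%:Z) w = iter i T (iter m Ti w).
Proof.
have [mi|im] := leqP m i.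
  have -> : - m%:Z + i%:Z = (i - m)%N%:Z by lia.
  by rewrite -{2}(subnK mi) iterD iter_invK.
(* [Negz k] stands for [- (k + 1)], hence the predecessor. *)
have -> : - m%:Z + i%:Z = Negz (m - i).-1 by lia.
rewrite /iterz prednK ?subn_gt0//.
by rewrite -{2}(subnKC (ltnW im)) iterD iter_invK.
Qed.

(** The window of times from [- m] to [n] is walked from its left end, so that only natural
    exponents occur; it has [m + n + 1] points. *)
Definition visits E m n w : R :=
  \sum_(0 <= i < (m + n).+1) \1_E (iter i T (iter m Ti w)).

Lemma maximal_gtP alpha E w : maximal_gt alpha E w <->
  exists m n, alpha * (m + n).+1%:R < visits E m n w.
Proof.
have avgE m n :
    ((n%:Z - (- m%:Z) + 1)%:~R^-1 *
         \sum_(0 <= i < (absz (n%:Z - (- m%:Z))%R).+1)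
           `|\1_E (iterz T (- m%:Z + i%:Z) w)|) =
    (m + n).+1%:R^-1 * visits E m n w.
  have -> : absz (n%:Z - (- m%:Z)) = (m + n)%N by lia.
  have -> : n%:Z - (- m%:Z) + 1 = (m + n).+1%:Z by lia.
  congr (_ * _); apply: eq_bigr => i _.
  by rewrite iterz_shift ger0_norm// indicE ler0n.
split=> [/ereal_sup_gt[_ [M [n [M0 n0 ->]]]]|[m [n mn]]].
  have [m Mm] : exists m : nat, M = - m%:Z by exists (absz M); lia.
  have [k nk] : exists k : nat, n = k%:Z by exists (absz n); lia.
  rewrite Mm nk avgE lte_fin mulrC ltr_pdivlMr ?ltr0n// => h.
  by exists m, k.
apply: (@lt_le_trans _ _ ((m + n).+1%:R^-1 * visits E m n w)%:E).
  by rewrite lte_fin mulrC ltr_pdivlMr ?ltr0n.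
apply: ereal_sup_ubound => /=; exists (- m%:Z), n%:Z.
by rewrite oppr_le0 avgE.
Qed.

Lemma measurable_visits E m n : measurable E ->
  measurable_fun [set: Omega] (visits E m n).
Proof.
move=> mE; apply: measurable_sum => i.
apply: measurableT_comp; first exact/measurable_indicP.
by apply: measurableT_comp; [exact: measurable_iter|exact: measurable_iter_inv].
Qed.

Lemma measurable_maximal_gt alpha E :
  measurable E -> measurable (maximal_gt alpha E).
Proof.
move=> mE.
have -> : maximal_gt alpha E = \bigcup_m \bigcup_n
    (visits E m n @^-1` `](alpha * (m + n).+1%:R), +oo[).
  apply/seteqP; split=> w.
    move=> /maximal_gtP[m [n mn]]; exists m => //; exists n => //=.
    by rewrite in_itv/= andbT.
  move=> [m _ [n _ /=]]; rewrite in_itv/= andbT => mn.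
  by apply/maximal_gtP; exists m, n.
apply: bigcup_measurable => m _; apply: bigcup_measurable => n _.
rewrite -[X in measurable X]setTI; apply: measurable_visits => //.
Qed.

Lemma sub_maximal_gt alpha E : alpha < 1 -> E `<=` maximal_gt alpha E.
Proof.
move=> alpha1 w Ew; apply/maximal_gtP; exists 0%N, 0%N.
by rewrite mulr1 /visits big_nat1 /= indicE mem_set.
Qed.

Lemma visits_gt0 E m n w : 0 < visits E m n w ->
  exists i, E (iter i T (iter m Ti w)).
Proof.
move=> v0; apply: contrapT => h; move: v0; rewrite /visits big1 ?ltxx// => i _.
by rewrite indicE memNset// => Ei; apply: h; exists i.
Qed.

(* Measures are compared through their real values, to allow linear arithmetic. *)
Definition prob A : R := fine (mu A).

Lemma probE A : measurable A -> mu A = (prob A)%:E.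
Proof. by move=> mA; rewrite /prob fineK// fin_num_measure. Qed.

Lemma le_prob A B : measurable A -> measurable B -> A `<=` B ->
  prob A <= prob B.
Proof.
by move=> mA mB AB; rewrite -lee_fin -!probE//; apply: le_measure; rewrite ?inE.
Qed.

Lemma prob_setDU A B : measurable A -> measurable B -> A `<=` B ->
  prob B = prob A + prob (B `\` A).
Proof.
move=> mA mB AB; apply: EFin_inj.
rewrite EFinD -!probE//; last exact: measurableD.
rewrite -measureU//; [|exact: measurableD|by rewrite setDIK].
by rewrite setDUK.
Qed.

Lemma prob_gt0 A : measurable A -> ((0 < mu A)%E) = (0 < prob A).
Proof. by move=> mA; rewrite probE// lte_fin. Qed.

Lemma tauberian_le alpha c :
  (forall E, measurable E -> prob (maximal_gt alpha E) <= c * prob E) ->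
  (tauberian T alpha <= c%:E)%E.
Proof.
move=> h; apply: ge_ereal_sup => _ [E [mE E0 ->]].
rewrite -/(maximal_gt _ _) !probE//; last exact: measurable_maximal_gt.
rewrite prob_gt0// in E0.
by rewrite inver gt_eqF// -EFinM lee_fin mulrC ler_pdivrMr// h.
Qed.

Lemma tauberian_ge alpha c E : measurable E -> 0 < prob E ->
  c * prob E <= prob (maximal_gt alpha E) -> (c%:E <= tauberian T alpha)%E.
Proof.
move=> mE E0 h; apply: (@le_trans _ _ ((mu E)^-1 * mu (maximal_gt alpha E))%E).
  rewrite !probE//; last exact: measurable_maximal_gt.
  by rewrite inver gt_eqF// -EFinM lee_fin [X in _ <= X]mulrC ler_pdivlMr.
by apply: ereal_sup_ubound; exists E; rewrite prob_gt0.
Qed.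

(** * Orbits of sets, and the gap above 1 at finite index *)

Definition forward_hull B : set Omega := \bigcup_n (iter n T @^-1` B).

(** The union of the full orbits through [B], written as an increasing union of translates of
    [forward_hull B], all of the same measure. *)
Definition hull B : set Omega := \bigcup_m (iter m Ti @^-1` forward_hull B).

Lemma hullP B w : hull B w <-> exists m n, B (iter n T (iter m Ti w)).
Proof.
split=> [[m _ [n _ ?]]|[m [n ?]]]; first by exists m, n.
by exists m => //; exists n.
Qed.

Lemma measurable_forward_hull B : measurable B -> measurable (forward_hull B).
Proof.
move=> mB; apply: bigcup_measurable => n _.
by apply: measurable_preimage mB; exact: measurable_iter.
Qed.

Lemma measurable_hull B : measurable B -> measurable (hull B).
Proof.
move=> /measurable_forward_hull mB; apply: bigcup_measurable => n _.
by apply: measurable_preimage mB; exact: measurable_iter_inv.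
Qed.

(* If the points entering B for the first time after exactly n steps had
   positive measure, they would have n.+1 disjoint iterates. *)
Lemma measure_first_entry N n B : measurable B ->
  ~ has_disjoint_iterates T N.+1 -> (N <= n)%N ->
  mu (seqDU (fun n => iter n T @^-1` B) n) = 0%E.
Proof.
move=> mB hN Nn; set F := fun _ => _.
have mF k : measurable (F k).
  by apply: measurable_preimage mB; exact: measurable_iter.
have mD : measurable (seqDU F n).
  by apply: measurableD => //; apply: bigsetU_measurable.
apply/eqP; rewrite eq_le measure_ge0 andbT leNgt; apply/negP => D0.
apply: hN; apply: (@has_disjoint_iterates_le _ _ _ _ _ _ n.+1) => //.
exists (seqDU F n); split => //.
suff dis i j w w' : (i < j)%N -> (j <= n)%N ->
    seqDU F n w -> seqDU F n w' -> iter i T w = iter j T w' -> False.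
  move=> i j /= ile jle [_ [[w Dw <-] [w' Dw' e]]].
  have [ij|ji|//] := ltngtP i j.
    by have := dis _ _ _ _ ij jle Dw Dw' (esym e).
  by have := dis _ _ _ _ ji ile Dw' Dw e.
move=> ij jn [_ Dw] [Fw' _] e; apply: Dw.
(* From the common point on the two orbits agree, so [w] is in [B] already after [n - j + i < n]
   steps. *)
rewrite -bigcup_mkord; exists (n - j + i)%N => /=; first by lia.
by rewrite /F /= iterD e -iterD subnK.
Qed.

(** Split by the time of first entry into [B]: times from [N] on contribute nothing, and each of the
    [N] earlier ones at most [mu B], the measure of a preimage of [B]. *)
Lemma measure_forward_hull N B : measurable B ->
  ~ has_disjoint_iterates T N.+1 ->
  (mu (forward_hull B) <= N%:R%:E * mu B)%E.
Proof.
move=> mB hN; rewrite /forward_hull.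
set F := fun n => iter n T @^-1` B.
have mF k : measurable (F k).
  by apply: measurable_preimage mB; exact: measurable_iter.
have mD n : measurable (seqDU F n).
  by apply: measurableD => //; apply: bigsetU_measurable.
rewrite seqDU_bigcup_eq measure_semi_bigcup//; last exact: bigcup_measurable.
rewrite (nneseries_split 0 N)//.
rewrite [X in (_ + X)%E]eseries0 ?adde0; last first.
  by move=> n; rewrite add0n => Nn _; exact: measure_first_entry hN Nn.
apply: (@le_trans _ _ (\sum_(0 <= k < 0 + N) mu B)%E).
  apply: lee_sum => n _; rewrite -[leRHS](mpt_preserving_iter n)//.
  by apply: le_measure (@subDsetl _ _ _); apply/mem_set; [exact: mD|exact: mF].
by rewrite sumr_const_nat subn0 mule_natl.
Qed.

Lemma prob_hull N B : measurable B ->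
  ~ has_disjoint_iterates T N.+1 -> prob (hull B) <= N%:R * prob B.
Proof.
move=> mB hN; rewrite -lee_fin EFinM -!probE//; last exact: measurable_hull.
apply: le_trans (measure_forward_hull mB hN).
have mH := measurable_forward_hull mB.
have mF m : measurable (iter m Ti @^-1` forward_hull B).
  by apply: measurable_preimage mH; exact: measurable_iter_inv.
have : mu \o (fun m => iter m Ti @^-1` forward_hull B) @ \oo --> mu (hull B).
  apply: nondecreasing_cvg_mu => //; first exact: measurable_hull.
  apply/nondecreasing_seqP => m; apply/subsetPset => w [n _ Bw].
  by exists n.+1 => //=; rewrite -iterS iterSr /= mpt_invK.
have -> : mu \o (fun m => iter m Ti @^-1` forward_hull B) =
    cst (mu (forward_hull B)).
  by apply/funext => m /=; rewrite mpt_preserving_iter_inv.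
by move=> /(cvg_lim (@ereal_hausdorff _)) <-; rewrite lim_cst.
Qed.

Lemma maximal_gt_sub_hull alpha E : 0 < alpha -> maximal_gt alpha E `<=` hull E.
Proof.
move=> alpha0 w /maximal_gtP[m [n mn]]; apply/hullP.
have /visits_gt0[i Ei] : 0 < visits E m n w.
  by apply: le_lt_trans mn; rewrite mulr_ge0// ltW.
by exists m, i.
Qed.

(* Restricting E to the orbits that meet [maximal_gt alpha E `\` E] does not
   change the averages along these orbits, and makes the measure of E at most N
   times that of [maximal_gt alpha E `\` E]. *)
Lemma tauberian_gap N alpha E : measurable E -> 0 < alpha < 1 ->
  ~ has_disjoint_iterates T N.+1 -> 0 < prob (maximal_gt alpha E `\` E) ->
  ((1 + N%:R^-1)%:E <= tauberian T alpha)%E.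
Proof.
move=> mE /andP[alpha0 alpha1] hN B0; pose B := maximal_gt alpha E `\` E.
have mB : measurable B by apply: measurableD => //; exact: measurable_maximal_gt.
pose E' := E `&` hull B.
have mE' : measurable E' by apply: measurableI => //; exact: measurable_hull.
have BE' : B `<=` maximal_gt alpha E'.
  move=> w Bw; have [/maximal_gtP[m [n mn]] _] := Bw.
  apply/maximal_gtP; exists m, n; apply: lt_le_trans mn _.
  apply: ler_sum => i _; rewrite !indicE; case: (boolP (_ \in E)) => // /set_mem Ei.
  rewrite mem_set//; split => //; apply/hullP.
  (* Going back [i] steps and forward [m] steps returns to [w], a point of [B]. *)
  exists i, m; rewrite iterK iter_invK; exact: Bw.
have E'N : prob E' <= N%:R * prob B.
  apply: le_trans (prob_hull mB hN).
  by apply: le_prob => //; [exact: measurable_hull|exact: subIsetr].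
(* This reverse bound yields [0 < N] and [0 < prob E']. *)
have BN : prob B <= N%:R * prob E'.
  apply: le_trans (prob_hull mE' hN).
  apply: le_prob => //; first exact: measurable_hull.
  by apply: subset_trans BE' _; exact: maximal_gt_sub_hull.
have N0 : 0 < N%:R :> R.
  rewrite lt_neqAle ler0n andbT eq_sym; apply/eqP => N0.
  by move: BN; rewrite N0 mul0r leNgt B0.
have E'0 : 0 < prob E'.
  by move: (lt_le_trans B0 BN); rewrite pmulr_rgt0.
apply: (@tauberian_ge _ _ E') => //.
rewrite (prob_setDU mE' (measurable_maximal_gt _ mE')); last first.
  exact: sub_maximal_gt.
rewrite mulrDl mul1r lerD2l; apply: (@le_trans _ _ (prob B)).
  by rewrite ler_pdivrMl.
apply: le_prob => //; first by apply: measurableD => //; exact: measurable_maximal_gt.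
by move=> w Bw; split; [exact: BE'|move=> [Ew _]; case: Bw].
Qed.

(** * The two-sided maximal inequality *)

(** The maximum of the sums of [f] over the first [k] points of the [S]-orbit of [w], for
    [0 <= k <= n], in the recursive form on which Garsia's argument rests. *)
Fixpoint pos_max (S : Omega -> Omega) (f : Omega -> R) n w : R :=
  if n is n'.+1 then Num.max 0 (f w + pos_max S f n' (S w)) else 0.

Lemma pos_max_ge0 S f n w : 0 <= pos_max S f n w.
Proof. by case: n => //= n; rewrite le_max lexx. Qed.

Lemma pos_max_leS S f n w : pos_max S f n w <= pos_max S f n.+1 w.
Proof.
elim: n w => [|n ih] w; first exact: pos_max_ge0.
by rewrite [leRHS]/= [leLHS]/= le_max2// lerD2l; exact: ih.
Qed.

Lemma pos_max_homo S f w : {homo pos_max S f ^~ w : m n / (m <= n)%N >-> m <= n}.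
Proof. by apply/nondecreasing_seqP => n; exact: pos_max_leS. Qed.

Lemma sum_le_pos_max S f n w : \sum_(0 <= i < n) f (iter i S w) <= pos_max S f n w.
Proof.
elim: n w => [|n ih] w; first by rewrite big_nil.
rewrite big_nat_recl//= le_max; apply/orP; right; rewrite lerD2l.
apply: le_trans (ih _); rewrite le_eqVlt; apply/orP; left; apply/eqP.
by apply: eq_bigr => i _; rewrite -iterSr.
Qed.

Lemma pos_max_le S f n w : (forall w, f w <= 1) -> pos_max S f n w <= n%:R.
Proof.
move=> f1; elim: n w => //= n ih w.
by rewrite ge_max ler0n/= -natr1 addrC lerD.
Qed.

Lemma measurable_pos_max S f n : measurable_fun setT S -> measurable_fun setT f ->
  measurable_fun setT (pos_max S f n).
Proof.
move=> mS mf; elim: n => [|n ih]; first exact: measurable_cst.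
apply: measurable_maxr; first exact: measurable_cst.
by apply: measurable_funD => //; exact: measurableT_comp.
Qed.

Lemma integral_preserving (S : Omega -> Omega) (g : Omega -> R) :
  measurable_fun setT S -> (forall A, measurable A -> mu (S @^-1` A) = mu A) ->
  measurable_fun setT g -> (forall w, 0 <= g w) ->
  (\int[mu]_w (g (S w))%:E = \int[mu]_w (g w)%:E)%E.
Proof.
move=> mS pS mg g0.
rewrite [RHS](eq_measure_integral (pushforward mu S)); last first.
  by move=> A mA _; rewrite -[LHS]pS.
rewrite ge0_integral_pushforward//.
- by apply/measurable_EFinP.
- by move=> w _; rewrite lee_fin.
Qed.

Lemma mpt_preserving_inv A : measurable A -> mu (Ti @^-1` A) = mu A.
Proof. exact: (mpt_preserving_iter_inv 1). Qed.

Section MaximalInequality.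
Variables (alpha : R) (E : set Omega).
Hypotheses (alpha01 : 0 < alpha < 1) (mE : measurable E).

Let f w : R := \1_E w - alpha.

Let mf : measurable_fun setT f.
Proof. by apply: measurable_funB => //; exact/measurable_indicP. Qed.

(** An average of [\1_E] exceeds [alpha] exactly when the sum of [f] over the window is positive;
    [G n] asks this for some window around [w] reaching at most [n] steps each way. *)
Let G n : set Omega :=
  [set w | 0 < f w + pos_max T f n (T w) + pos_max Ti f n (Ti w)].

Let maximal_gt_sub : maximal_gt alpha E `<=` \bigcup_n G n.
Proof.
move=> w /maximal_gtP[m [n mn]]; exists (m + n)%N => //=.
have : 0 < \sum_(0 <= i < (m + n).+1) f (iter i T (iter m Ti w)).
  rewrite sumrB big_const_nat subn0 iter_addr_0.
  by rewrite subr_gt0 -mulr_natr.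
move=> /lt_le_trans; apply.
(* The first [m] terms are the past, the next one is [f w], the others are the future. *)
rewrite -addnS big_mkord big_split_ord /= big_ord_recl /= addn0 iter_invK.
rewrite addrC lerD ?lerD2l//.
- apply: le_trans (pos_max_homo T f (T w) (leq_addl m n)).
  apply: le_trans (sum_le_pos_max _ _ _ _); rewrite big_mkord le_eqVlt.
  apply/orP; left; apply/eqP; apply: eq_bigr => i _; congr f.
  by rewrite /bump /= -iterSr add1n addnC iterD iter_invK.
- apply: le_trans (pos_max_homo Ti f (Ti w) (leq_addr n m)).
  apply: le_trans (sum_le_pos_max _ _ _ _); rewrite big_mkord le_eqVlt.
  (* The past is listed from its far end, while [pos_max Ti] starts next to [w]. *)
  rewrite (reindex_inj rev_ord_inj)/=.
  apply/orP; left; apply/eqP; apply: eq_bigr => i _; congr f.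
  have -> : iter m Ti w = iter (m - i.+1) Ti (iter i.+1 Ti w).
    by rewrite -iterD subnK.
  by rewrite iter_invK -iterSr.
Qed.

Let mG n : measurable (G n).
Proof.
rewrite -[X in measurable X]setTI.
have -> : G n = (fun w => f w + pos_max T f n (T w) + pos_max Ti f n (Ti w))
    @^-1` `]0, +oo[ by apply/seteqP; split => w /=; rewrite in_itv/= andbT.
apply: measurable_funD => //; first apply: measurable_funD => //.
- apply: measurableT_comp; last exact: mpt_measurable_fun.
  by apply: measurable_pos_max => //; exact: mpt_measurable_fun.
- apply: measurableT_comp; last exact: mpt_measurable_inv.
  by apply: measurable_pos_max => //; exact: mpt_measurable_inv.
Qed.

(* On E both sides agree; off E, at w in G n, at least one of the two maxima at
   T w, T^-1 w exceeds alpha, or their sum does. *)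
Let pointwise n w :
  alpha * \1_(G n `\` E) w + (pos_max T f n.+1 w + pos_max Ti f n.+1 w) <=
  2 * (1 - alpha) * \1_E w + (pos_max T f n (T w) + pos_max Ti f n (Ti w)).
Proof.
have /andP[a0 a1] := alpha01.
have p0 := pos_max_ge0 T f n (T w); have q0 := pos_max_ge0 Ti f n (Ti w).
rewrite /= !indicE !maxEle.
set p := pos_max T f n (T w) in p0 *; set q := pos_max Ti f n (Ti w) in q0 *.
case: (boolP (w \in E)) => wE.
  have fw : f w = 1 - alpha by rewrite /f indicE wE.
  rewrite memNset; last by case => _; apply; exact/set_mem.
  by rewrite fw mulr0 mulr1; case: (leP 0 (_ + p)) => ?; case: (leP 0 (_ + q)) => ?; lra.
have fw : f w = - alpha by rewrite /f indicE (negbTE wE) sub0r.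
rewrite mulr0; case: (boolP (w \in _ `\` _)) => wG.
  have [] := set_mem wG; rewrite [G n w]/G /= -/p -/q fw => pq _.
  by rewrite mulr1; case: (leP 0 (_ + p)) => ?; case: (leP 0 (_ + q)) => ?; lra.
by rewrite fw mulr0; case: (leP 0 (_ + p)) => ?; case: (leP 0 (_ + q)) => ?; lra.
Qed.

(** Integrate [pointwise]. By invariance the maxima at [T w] and [Ti w] have the integrals of
    [pos_max _ f n], which are at most those of [pos_max _ f n.+1] on the left; these are finite,
    since [f <= 1], and cancel. *)
Let prob_G n : alpha * prob (G n `\` E) <= 2 * (1 - alpha) * prob E.
Proof.
have /andP[a0 a1] := alpha01.
have mT : measurable_fun setT T := mpt_measurable_fun T.
have mTi : measurable_fun setT Ti := mpt_measurable_inv T.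
have mGE : measurable (G n `\` E) by exact: measurableD.
have mpm S k : measurable_fun setT S ->
  measurable_fun setT (fun w => (pos_max S f k w)%:E).
  by move=> mS; apply/measurable_EFinP; exact: measurable_pos_max.
have fin S k : measurable_fun setT S -> 
    (\int[mu]_w (pos_max S f k w)%:E)%E \is a fin_num.
  move=> mS; rewrite ge0_fin_numE; last first.
    by apply: integral_ge0 => w _; rewrite lee_fin pos_max_ge0.
  apply: (@le_lt_trans _ _ (\int[mu]_w (k%:R : R)%:E)%E).
    apply: ge0_le_integral => //.
    - by move=> w _; rewrite lee_fin pos_max_ge0.
    - exact: mpm.
    - move=> w _; rewrite lee_fin pos_max_le// => v.
      rewrite /f indicE; case: (_ \in _) => /=; lra.
  by rewrite integral_cst//= probability_setT mule1 ltry.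
have leS S : measurable_fun setT S -> 
    (\int[mu]_w (pos_max S f n w)%:E <= \int[mu]_w (pos_max S f n.+1 w)%:E)%E.
  move=> mS; apply: ge0_le_integral => //.
  - by move=> w _; rewrite lee_fin pos_max_ge0.
  - exact: mpm.
  - exact: mpm.
  - by move=> w _; rewrite lee_fin pos_max_leS.
have int2 c A (g h : Omega -> R) : 0 <= c -> measurable A ->
    measurable_fun setT g -> measurable_fun setT h ->
    (forall w, 0 <= g w) -> (forall w, 0 <= h w) ->
    (\int[mu]_w (c * \1_A w + (g w + h w))%:E =
     c%:E * mu A + (\int[mu]_w (g w)%:E + \int[mu]_w (h w)%:E))%E.
  move=> c0 mA mg mh g0 h0.
  have mA1 : measurable_fun setT (\1_A : _ -> R) by exact/measurable_indicP.
  under eq_integral do rewrite EFinD EFinD EFinM.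
  rewrite ge0_integralD//; last 4 first.
  - by move=> w _; rewrite -EFinM lee_fin mulr_ge0// indicE ler0n.
  - by apply/measurable_EFinP; exact: measurable_funM.
  - by move=> w _; rewrite -EFinD lee_fin addr_ge0.
  - by apply/measurable_EFinP; exact: measurable_funD.
  rewrite ge0_integralZl_EFin//; last exact/measurable_EFinP.
  rewrite integral_indic// setIT ge0_integralD//.
  - by move=> w _; rewrite lee_fin.
  - exact/measurable_EFinP.
  - by move=> w _; rewrite lee_fin.
  - exact/measurable_EFinP.
have mpmR S k : measurable_fun setT S -> measurable_fun setT (pos_max S f k).
  by move=> mS; exact: measurable_pos_max.
have : (\int[mu]_w (alpha * \1_(G n `\` E) w +
            (pos_max T f n.+1 w + pos_max Ti f n.+1 w))%:E <=
  \int[mu]_w (2 * (1 - alpha) * \1_E w +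
            (pos_max T f n (T w) + pos_max Ti f n (Ti w)))%:E)%E.
  apply: ge0_le_integral => //.
  - move=> w _; rewrite lee_fin addr_ge0//; last by rewrite addr_ge0 ?pos_max_ge0.
    by rewrite mulr_ge0 ?indicE ?ler0n// ltW.
  - apply/measurable_EFinP; apply: measurable_funD.
      by apply: measurable_funM => //; exact/measurable_indicP.
    by apply: measurable_funD; exact: mpmR.
  - apply/measurable_EFinP; apply: measurable_funD.
      by apply: measurable_funM => //; exact/measurable_indicP.
    by apply: measurable_funD; (apply: measurableT_comp; first exact: mpmR).
  - by move=> w _; rewrite lee_fin pointwise.
rewrite !int2//; try (by move=> w; exact: pos_max_ge0); try exact: mpmR; try lra;
  try by (apply: measurableT_comp; first exact: mpmR).
rewrite (@integral_preserving T)//; [|exact: mpt_preserving|exact: mpmR|]; last first.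
  by move=> w; exact: pos_max_ge0.
rewrite (@integral_preserving Ti)//; [|exact: mpt_preserving_inv|exact: mpmR|]; last first.
  by move=> w; exact: pos_max_ge0.
move=> h; rewrite -lee_fin !EFinM -!probE//.
rewrite -(@leeD2rE _ (\int[mu]_w (pos_max T f n.+1 w)%:E +
  \int[mu]_w (pos_max Ti f n.+1 w)%:E)%E); last by rewrite fin_numD !fin.
apply: le_trans h _; rewrite EFinM leeD2l// leeD// leS//.
Qed.

(** The sets [G n] increase, so [prob_G] passes to their union by continuity from below. *)
Lemma prob_maximal_gt_setD :
  alpha * prob (maximal_gt alpha E `\` E) <= 2 * (1 - alpha) * prob E.
Proof.
have /andP[a0 a1] := alpha01.
have mGE n : measurable (G n `\` E) by exact: measurableD.
have mU : measurable (\bigcup_n (G n `\` E)) by exact: bigcup_measurable.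
apply: (@le_trans _ _ (alpha * prob (\bigcup_n (G n `\` E)))).
  apply: ler_wpM2l; first exact: ltW.
  apply: le_prob => //; first by apply: measurableD => //; exact: measurable_maximal_gt.
  by move=> w [/maximal_gt_sub[n _ Gw] Ew]; exists n.
have : mu \o (fun n => G n `\` E) @ \oo --> mu (\bigcup_n (G n `\` E)).
  apply: nondecreasing_cvg_mu => //.
  apply/nondecreasing_seqP => n; apply/subsetPset => w [Gw Ew]; split => //.
  by apply: lt_le_trans Gw _; rewrite !lerD// pos_max_leS.
move=> cvgG; rewrite mulrC -ler_pdivlMr// -lee_fin -probE//.
rewrite -(cvg_lim (@ereal_hausdorff _) cvgG).
apply: lime_le; first by apply/cvg_ex; eexists; exact: cvgG.
by apply: nearW => n /=; rewrite probE// lee_fin ler_pdivlMr// mulrC.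
Qed.

End MaximalInequality.

Lemma tauberian_le_two_div alpha : 0 < alpha < 1 ->
  (tauberian T alpha <= (2 * alpha^-1 - 1)%:E)%E.
Proof.
move=> alpha01; have /andP[alpha0 alpha1] := alpha01.
apply: tauberian_le => E mE.
rewrite (prob_setDU mE (measurable_maximal_gt _ mE)); last first.
  exact: sub_maximal_gt.
have := prob_maximal_gt_setD alpha01 mE; set p := prob (_ `\` _); set q := prob E.
move=> h; have : p <= 2 * (1 - alpha) * q / alpha by rewrite ler_pdivlMr// mulrC.
suff -> : 2 * (1 - alpha) * q / alpha = (2 / alpha - 2) * q by lra.
by field; rewrite gt_eqF.
Qed.

(** * Towers of disjoint iterates and the case of infinite index *)

(** The same stretch of orbit serves all its points: seen from time [i], it reaches [i - p] steps
    back and [p + l - 1 - i] forward. *)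
Lemma maximal_gt_window alpha E a p l i : (p <= i < p + l)%N ->
  alpha * l%:R < \sum_(0 <= k < l) \1_E (iter (p + k) T a) ->
  maximal_gt alpha E (iter i T a).
Proof.
move=> /andP[pi ipl] h; apply/maximal_gtP; exists (i - p)%N, (p + l - i.+1)%N.
have le : ((i - p) + (p + l - i.+1)).+1 = l by lia.
rewrite /visits le; apply: lt_le_trans h _.
rewrite le_eqVlt; apply/orP; left; apply/eqP.
apply: eq_bigr => k _; congr (\1_E _).
have -> : iter i T a = iter (i - p) T (iter p T a) by rewrite -iterD subnK.
by rewrite iterK addnC iterD.
Qed.

Lemma sum_indic_block E a p l q L : (p <= q)%N -> (q + L <= p + l)%N ->
  (forall k, (q <= k < q + L)%N -> E (iter k T a)) ->
  L%:R <= \sum_(0 <= k < l) \1_E (iter (p + k) T a) :> R.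
Proof.
move=> pq qL hE.
rewrite (@big_cat_nat _ _ _ (q - p))//=; last by lia.
apply: ler_wpDl; first by apply: sumr_ge0 => k _; rewrite indicE ler0n.
rewrite (@big_cat_nat _ _ _ (q - p + L))//=; [|by lia|by lia].
apply: ler_wpDr; first by apply: sumr_ge0 => k _; rewrite indicE ler0n.
rewrite big_nat (eq_bigr (fun=> 1)); last first.
  move=> k /andP[qk kL]; rewrite indicE mem_set//; apply: hE; lia.
by rewrite -big_nat sumr_const_nat addKn.
Qed.

(** Take for [E] the middle [L] levels of a tower of height [n + L + n]. Every level lies in a
    window of [n + L] levels containing the whole block, of average at least [L / (n + L) > alpha].
    The superlevel set thus contains the tower, whose measure is at least [(2 n + L) / L] times that
    of [E]. *)
Lemma tauberian_block alpha n L : (0 < L)%N -> alpha * (n + L)%:R < L%:R ->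
  has_disjoint_iterates T (n + L + n) ->
  ((1 + 2 * (n%:R / L%:R))%:E <= tauberian T alpha)%E.
Proof.
move=> L0 aL [A [mA A0 tA]].
have mTA i : measurable (iter i T @` A) by exact: image_iter_measurable.
have pTA i : prob (iter i T @` A) = prob A.
  by rewrite /prob measure_image_iter.
pose E := \big[setU/set0]_(k < L) (iter (n + k) T @` A).
have mE : measurable E by exact: bigsetU_measurable.
have inE k a : A a -> (n <= k < n + L)%N -> E (iter k T a).
  move=> Aa /andP[nk kL].
  have -> : E = \bigcup_(k < L) (iter (n + k) T @` A) by rewrite bigcup_mkord.
  exists (k - n)%N => /=.
    by lia.
  by exists a => //; rewrite subnKC.
have EL : prob E <= L%:R * prob A.
  rewrite -lee_fin EFinM -!probE//.
  apply: (@le_trans _ _ (\sum_(k < L) mu (iter (n + k) T @` A))%E).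
    exact: (@content_subadditive _ _ _ mu _ (fun k => iter (n + k) T @` A)).
  rewrite (eq_bigr (fun=> mu A)); last by move=> k _; rewrite measure_image_iter.
  by rewrite sumr_const card_ord mule_natl.
have E0 : 0 < prob E.
  rewrite prob_gt0// in A0; apply: (lt_le_trans A0); rewrite -(pTA n).
  apply: le_prob => // _ [a Aa <-]; apply: inE => //; lia.
apply: (@tauberian_ge _ _ E) => //.
apply: (@le_trans _ _ ((n + L + n)%:R * prob A)).
  have -> : 1 + 2 * (n%:R / L%:R) = (n + L + n)%:R / L%:R :> R.
    by rewrite !natrD; field; rewrite pnatr_eq0 -lt0n.
  by rewrite -mulrA ler_wpM2l// ler_pdivrMl ?ltr0n.
pose F := \big[setU/set0]_(k < n + L + n) (iter k T @` A).
have mF : measurable F by exact: bigsetU_measurable.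
have -> : (n + L + n)%:R * prob A = prob F.
  apply: EFin_inj; rewrite EFinM -!probE//.
  rewrite (@measure_semi_additive_ord_I _ _ _ mu (fun k => iter k T @` A))//.
  rewrite (eq_bigr (fun=> mu A)); last by move=> k _; exact: measure_image_iter.
  by rewrite sumr_const card_ord mule_natl.
apply: le_prob => //; first exact: measurable_maximal_gt.
have -> : F = \bigcup_(k < n + L + n) (iter k T @` A) by rewrite bigcup_mkord.
move=> _ [i /= iN [a Aa <-]].
(* The lower [n + L] levels use the window starting at the bottom, the top [n] levels the one
   starting at level [n]. *)
have [inL|nLi] := ltnP i (n + L).
  apply: (@maximal_gt_window _ _ _ 0 (n + L)%N); first by lia.
  apply: lt_le_trans aL _; apply: (@sum_indic_block _ _ _ _ n) => //.
  by move=> k kL; exact: inE.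
apply: (@maximal_gt_window _ _ _ n (n + L)%N); first by lia.
apply: lt_le_trans aL _; apply: (@sum_indic_block _ _ _ _ n) => //; first lia.
by move=> k kL; exact: inE.
Qed.

Lemma tauberian_pinfty alpha : 0 < alpha < 1 ->
  (forall N, has_disjoint_iterates T N) ->
  tauberian T alpha = (2 * alpha^-1 - 1)%:E.
Proof.
move=> alpha01 hT; have /andP[alpha0 alpha1] := alpha01.
apply/eqP; rewrite eq_le tauberian_le_two_div//=.
have a1 : 0 < alpha^-1 - 1 by rewrite subr_gt0 invf_gt1.
apply/lee_subgt0Pr => e e0.
(* With [q = n / L], the upper bound is the hypothesis of [tauberian_block], and [1 + 2 q] is within
   [e] of the target. The maximum with 0 makes the numerator a natural number. *)
have /rat_in_itvoo[q] : Num.max 0 (alpha^-1 - 1 - e / 2) < alpha^-1 - 1.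
  by rewrite gt_max a1; lra.
rewrite in_itv/= gt_max => /andP[/andP[q0 qe] qa].
have q0' : 0 < q by move: q0; rewrite ltr0q.
have [n nq] : exists n : nat, numq q = n%:Z.
  exists (absz (numq q)); rewrite gez0_abs// numq_ge0; exact: ltW.
have [L Lq] : exists L : nat, denq q = L%:Z.
  by exists (absz (denq q)); rewrite absz_denq.
have L0 : (0 < L)%N by rewrite -ltz_nat -Lq denq_gt0.
have qE : ratr q = n%:R / L%:R :> R by rewrite /ratr nq Lq.
have LR : 0 < L%:R :> R by rewrite ltr0n.
have := @tauberian_block alpha n L L0 _ (hT _).
rewrite -qE => h; apply: le_trans (h _); first by rewrite -EFinB lee_fin; lra.
have : n%:R < (alpha^-1 - 1) * L%:R by rewrite -ltr_pdivrMr// -qE.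
move=> nL; rewrite natrD -[ltRHS](mulVKf (lt0r_neq0 alpha0)) ltr_pM2l//.
by move: nL; rewrite mulrBl mul1r ltrBrDr.
Qed.

(** * Values of the constant at finite index *)

Lemma tauberian_ge1 alpha : alpha < 1 -> (1 <= tauberian T alpha)%E.
Proof.
move=> alpha1; have mS : measurable [set: Omega] by [].
have S0 : 0 < prob [set: Omega] by rewrite /prob probability_setT.
apply: (@tauberian_ge _ _ [set: Omega]) => //.
rewrite mul1r; apply: le_prob => //; [exact: measurable_maximal_gt|exact: sub_maximal_gt].
Qed.

(** Here [prob_hull] with [N = 1] says that the orbits through [E] add no measure to [E]. *)
Lemma tauberian_index1 alpha : 0 < alpha < 1 -> ~ has_disjoint_iterates T 2 ->
  tauberian T alpha = 1%E.
Proof.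
move=> /andP[alpha0 alpha1] hT; apply/eqP; rewrite eq_le tauberian_ge1// andbT.
apply: tauberian_le => E mE; apply: le_trans (prob_hull mE hT).
apply: le_prob; [exact: measurable_maximal_gt|exact: measurable_hull|].
exact: maximal_gt_sub_hull.
Qed.

(** By [tauberian_gap], below the threshold no superlevel set gains measure outside [E]. *)
Lemma tauberian_eq1 N alpha : 0 < alpha < 1 -> ~ has_disjoint_iterates T N.+1 ->
  (tauberian T alpha < (1 + N%:R^-1)%:E)%E -> tauberian T alpha = 1%E.
Proof.
move=> alpha01 hN; have /andP[alpha0 alpha1] := alpha01.
rewrite ltNge => /negP h; apply/eqP; rewrite eq_le tauberian_ge1// andbT.
apply: tauberian_le => E mE.
rewrite (prob_setDU mE (measurable_maximal_gt _ mE)); last first.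
  exact: sub_maximal_gt.
rewrite mul1r gerDl leNgt; apply/negP => B0; apply: h.
exact: tauberian_gap hN B0.
Qed.

(** If [A] is disjoint from its image, the two-point window [a], [T a] has average at least [1 / 2].
    So the image lies in the superlevel set minus [A], and [tauberian_gap] applies. *)
Lemma tauberian_gt1 N alpha :
  0 < alpha < 1 / 2 -> ~ has_disjoint_iterates T N.+1 ->
  has_disjoint_iterates T 2 -> ((1 + N%:R^-1)%:E <= tauberian T alpha)%E.
Proof.
move=> alpha01 hN [A [mA A0 tA]].
have mTA : measurable (iter 1 T @` A) by exact: image_iter_measurable.
apply: (tauberian_gap mA _ hN); first by lra.
rewrite prob_gt0// in A0; apply: (lt_le_trans A0).
have -> : prob A = prob (iter 1 T @` A) by rewrite /prob measure_image_iter.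
apply: le_prob => //.
  by apply: measurableD => //; exact: measurable_maximal_gt.
move=> w TAw; split.
  have [a Aa <-] := TAw; apply: (@maximal_gt_window _ _ _ 0 2) => //.
  rewrite big_ltn// big_nat1 /= (_ : \1_A a = 1); last by rewrite indicE mem_set.
  rewrite (@lt_le_trans _ _ 1)//; first by lra.
  by rewrite lerDl indicE ler0n.
move=> Aw; suff : 0%N = 1%N by [].
by apply: tA => //; exists w; split=> //; exists w.
Qed.

End Transformation.

(** * Smoothness and the dichotomy *)

Lemma is_derive_inv_pow (R : realType) (c e : R) (k : nat) (x : R) : x != 0 ->
  is_derive x 1 (fun y => c * y^-1 ^+ k + e) (- (c * k%:R) * x^-1 ^+ k.+1).
Proof.
move=> x0.
have dV : is_derive x 1 (@GRing.inv R) (- x ^- 2).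
  by have := is_deriveV x0 (is_derive_id x 1); rewrite scaler1.
have -> : (fun y => c * y^-1 ^+ k + e) = c \*: (@GRing.inv R) ^+ k + cst e.
  by apply/funext => y; rewrite !fctE.
have dX := is_deriveX k dV.
apply: is_derive_eq; rewrite addr0 /GRing.scale /=.
case: k {dX} => [|k]; first by rewrite !(mul0r, mulr0, oppr0).
by rewrite -exprVn -[k.+2]addn2 exprD; ring.
Qed.

Lemma smooth_on_inv_affine (R : realType) (f : R -> \bar R) (c e : R) :
  (forall x, x \in `]0, 1[ -> f x = (c * x^-1 + e)%:E) ->
  smooth_on `]0, 1[%classic f.
Proof.
move=> fE; have near01 (x : R) (P : R -> Prop) : x \in `]0, 1[ ->
    (forall y, y \in `]0, 1[ -> P y) -> \near x, P x.
  move=> x01 h; near=> y; apply: h.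
  by near: y; exact: near_in_itvoo.
split=> [x /= x01|n x /= x01]; first by rewrite fE.
(* This shape is stable under differentiation, and an identity on the open interval passes to
   derivatives, which are local. *)
have [k [c' [e' h]]] : exists k c' e', forall y : R, y \in `]0, 1[ ->
    derive1n n (fine \o f) y = c' * y^-1 ^+ k + e'.
  elim: n => [|n [k [c' [e' h]]]].
    by exists 1, c, e => y y01; rewrite derive1n0 /= fE.
  exists k.+1, (- (c' * k%:R)), 0 => y y01.
  rewrite derive1nS derive1E addr0.
  rewrite (@near_eq_derive _ _ _ _ (fun y : R => c' * y^-1 ^+ k + e')); last first.
    exact: near01.
  have y0 : y != 0 by move: y01; rewrite in_itv/= => /andP[/lt0r_neq0].
  by have := is_derive_inv_pow c' e' k y0 => /@derive_val.
have x0 : x != 0 by move: x01; rewrite in_itv/= => /andP[/lt0r_neq0].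
have := is_derive_inv_pow c' e' k x0 => /near_eq_is_derive dx.
suff /dx[] : \near x, c' * x^-1 ^+ k + e' = derive1n n (fine \o f) x by [].
by apply: near01 => // y y01; rewrite h.
Unshelve. all: by end_near. Qed.

Lemma smooth_on_index (d : measure_display) (Omega : measurableType d)
    (R : realType) (mu : probability Omega R) (T : invertible_mpt mu) N :
  smooth_on `]0, 1[%classic (tauberian T) ->
  ~ has_disjoint_iterates T N.+1 -> ~ has_disjoint_iterates T 2.
Proof.
move=> [tfin tder] hN h2.
have t_le (x : R) : x \in `]0, 1[ -> fine (tauberian T x) <= 2 * x^-1 - 1.
  move=> x01; rewrite -lee_fin fineK ?tfin//; apply: tauberian_le_two_div.
  by rewrite in_itv in x01.
pose c : R := 1 + N%:R^-1.
have N1 : (1 < N)%N.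
  rewrite ltnNge; apply/negP => N1; apply: hN.
  exact: has_disjoint_iterates_le h2.
have NR : 0 < N%:R^-1 :> R by rewrite invr_gt0 ltr0n; lia.
have NR1 : N%:R^-1 <= 1 :> R by rewrite invf_le1 ?ltr0n ?ler1n//; lia.
(* A value in the middle of the gap: continuity, from derivability at order 0, forces it, while
   [tauberian_eq1] excludes it. *)
have [alpha alpha01 talpha] : exists2 alpha : R, alpha \in `]0, 1[ &
    fine (tauberian T alpha) = 1 + N%:R^-1 / 2.
  pose a : R := 1 / 3.
  (* Chosen so that [2 / b - 1 = 1 + N%:R^-1 / 2], while [a = 1 / 3] lies below the [1 / 2] of
     [tauberian_gt1]. *)
  pose b : R := (1 + N%:R^-1 / 4)^-1.
  have b34 : 3 / 4 <= b.
    rewrite /b -[leLHS]invrK lef_pV2 ?posrE ?invr_gt0; lra.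
  have b1 : b < 1 by rewrite /b invf_lt1; lra.
  have ab : a <= b by rewrite /a; lra.
  have abI x : x \in `[a, b] -> x \in `]0, 1[.
    by rewrite !in_itv/= /a => /andP[? ?]; apply/andP; split; lra.
  have [] := @IVT _ (fine \o tauberian T) a b (1 + N%:R^-1 / 2) ab.
  - apply: derivable_within_continuous => x /abI x01.
    exact: (tder 0%N x x01).
  - have ta : 1 + N%:R^-1 <= fine (tauberian T a).
      have a01 : a \in `]0, 1[ by apply: abI; rewrite in_itv/= lexx.
      rewrite -lee_fin fineK ?tfin//; apply: tauberian_gt1 hN h2; rewrite /a; lra.
    have tb : fine (tauberian T b) <= 1 + N%:R^-1 / 2.
      have b01 : b \in `]0, 1[ by apply: abI; rewrite in_itv/= lexx ab.
      apply: le_trans (t_le _ b01) _; rewrite /b invrK; lra.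
    by rewrite ge_min le_max /= tb orbT/=; apply/orP; left; lra.
  by move=> x /abI x01 tx; exists x.
have tE : tauberian T alpha = (1 + N%:R^-1 / 2)%:E by rewrite -talpha fineK ?tfin.
have t1 : tauberian T alpha = 1%E.
  apply: tauberian_eq1 hN _; first by rewrite in_itv in alpha01.
  by rewrite tE lte_fin; lra.
by move: tE; rewrite t1 => -[]; lra.
Qed.

Theorem corollary2 (d : measure_display) (Omega : measurableType d)
    (R : realType) (mu : probability Omega R) (T : invertible_mpt mu) :
  smooth_on `]0%R, 1%R[%classic (tauberian T) <->
  mpt_index T = (1%N)%:E%E \/ mpt_index T = +oo%E.
Proof.
split=> [sT|[/mpt_index_finiteP[_ hT]|/mpt_index_pinftyP hT]].
- have [|] := pselect (forall N, (0 < N)%N -> has_disjoint_iterates T N.+1).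
    by move=> /mpt_index_pinftyP; right.
  (* An index that is not infinite bounds the number of disjoint iterates; smoothness then rules out
     even two. *)
  move=> /existsNP[N /not_implyP[_ hN]]; left.
  apply/mpt_index_finiteP; split.
    by split=> //; exact: has_disjoint_iterates1.
  move=> m [_ hm]; rewrite leqNgt; apply/negP => m1.
  by apply: (smooth_on_index sT hN); exact: has_disjoint_iterates_le hm.
- apply: (@smooth_on_inv_affine _ _ 0 1) => x; rewrite in_itv/= => x01.
  rewrite mul0r add0r; apply: tauberian_index1 => // h2.
  by have := hT 2 (conj isT h2).
- apply: (@smooth_on_inv_affine _ _ 2 (-1)) => x; rewrite in_itv/= => x01.
  (* Infinite index only speaks of two or more iterates; 0 and 1 are treated apart. *)
  apply: tauberian_pinfty => // -[|N].
    by apply: has_disjoint_iterates_le (has_disjoint_iterates1 T).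
  case: N => [|N]; [exact: has_disjoint_iterates1|exact: hT].
Qed.
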